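(* Let $k\in\{1,2\}$ and let $G$ be a connected $\mathbb{Z}^k$-gain graph. Then there exists a placement-lattice $(p,L)$ of $G$ in $\mathbb{R}^2$ such that $(G,p,L)$ is a fixed lattice flexible full $k$-periodic framework if and only if either (i) $G$ has a fixed lattice NBAC-colouring, or (ii) $G$ is balanced.
   Context: Gain graphs. For an additive abelian group $\Gamma$, a $\Gamma$-gain graph $G$ has a finite vertex set $V(G)$ and a (possibly infinite) edge set $E(G)$ of triples $(v,w,\gamma)\in V(G)^2\times\Gamma$, where $(v,w,\gamma)$ and $(w,v,-\gamma)$ are identified as the same edge, and no edge has the form $(v,v,0)$. Loops $(v,v,\gamma)$ with $\gamma\ne0$ and parallel edges are allowed. A circuit $C$ of length $n\ge1$ is a closed walk: a sequence $(e_1,\dots,e_n)$ of edges with orientations chosen so that $e_i=(v_i,v_{i+1},\gamma_i)$ and $v_{n+1}=v_1$; repetitions are allowed. Its gain is $\psi(C)=\gamma_1+\dots+\gamma_n$; $C$ is balanced if $\psi(C)=0$. A subgraph is balanced if all its circuits are balanced, and unbalanced otherwise. Colourings. For $\delta:E(G)\to\{\text{red},\text{blue}\}$, let $G^\delta_{\text{red}}$ (resp. $G^\delta_{\text{blue}}$) be the subgraph with vertex set $V(G)$ and all red (resp. blue) edges. An almost red circuit is a circuit with exactly one blue edge (counted with multiplicity, all other edges red); an almost blue circuit is a circuit with exactly one red edge. $\delta$ is an NBAC-colouring if it is surjective and there are no balanced almost red circuits and no balanced almost blue circuits. An NBAC-colouring is a fixed lattice NBAC-colouring if either $G^\delta_{\text{red}}$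 is balanced and $G$ has no almost blue circuits, or $G^\delta_{\text{blue}}$ is balanced and $G$ has no almost red circuits. Frameworks. A placement-lattice of a $\mathbb{Z}^k$-gain graph $G$ in $\mathbb{R}^2$ is a pair $(p,L)$ with $p:V(G)\to\mathbb{R}^2$ and $L\in M_{2\times k}(\mathbb{R})$ such that $p(v)\ne p(w)+L\gamma$ for every $(v,w,\gamma)\in E(G)$; $(G,p,L)$ is then a $k$-periodic framework, and it is full if $L$ is injective. $(G,p,L)$ and $(G,p',L')$ are equivalent if $\|p(v)-p(w)-L\gamma\|^2=\|p'(v)-p'(w)-L'\gamma\|^2$ for all $(v,w,\gamma)\in E(G)$; $(p,L)$ and $(p',L')$ are congruent if this equality holds for all $v,w\in V(G)$ and $\gamma\in\mathbb{Z}^k$. $L$ and $L'$ are orthogonally equivalent if $(L\gamma)\cdot(L\mu)=(L'\gamma)\cdot(L'\mu)$ for all $\gamma,\mu\in\mathbb{Z}^k$. A flex of $(G,p,L)$ is a continuous path $t\mapsto(p_t,L_t)$, $t\in[0,1]$, of placement-lattices of $G$ with $(p_0,L_0)=(p,L)$ and $(G,p_t,L_t)$ equivalent to $(G,p,L)$ for all $t$; it is a fixed lattice flex if moreover $L_t$ is orthogonally equivalent to $L$ for all $t$; it is trivial if $(p_t,L_t)$ is congruent to $(p,L)$ for all $t$. $(G,p,L)$ is fixed lattice flexible if it has a non-trivial fixed lattice flex.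
   Formalization: The formal theorem also assumes that G has at least one edge; this excludes only the single-vertex graph without edges, which is balanced but has only trivial fixed lattice flexes, so the equivalence fails for it. *)

(* Defs.v *)
From HB Require Import structures.
From mathcomp Require Import all_boot all_order all_algebra.
From mathcomp Require Import all_classical all_reals all_analysis.

Set Implicit Arguments.
Unset Strict Implicit.
Unset Printing Implicit Defensive.

Import Order.TTheory GRing.Theory Num.Theory.
Import numFieldNormedType.Exports.

Local Open Scope classical_set_scope.
Local Open Scope ring_scope.

(* An oriented edge (v, w, gamma). *)
Definition dart (V : finType) (Gam : zmodType) : Type := (V * V * Gam)%type.

Section Darts.
Variables (V : finType) (Gam : zmodType).
Implicit Type e : dart V Gam.

Definition src e : V := e.1.1.
Definition tgt e : V := e.1.2.
Definition gain e : Gam := e.2.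
Definition rev_dart e : dart V Gam := (tgt e, src e, - gain e).
End Darts.

(* The identification of (v, w, gamma) with (w, v, - gamma) is encoded by an
   edge set closed under reversal: an edge is an orbit {e, rev_dart e}, and an
   element of the edge set is an edge together with an orientation. The edge
   set is an arbitrary, possibly infinite, set. *)
Record gainGraph (Gam : zmodType) := GainGraph {
  vert : finType;
  edges : set (dart vert Gam);
  edges_rev : forall e, edges e -> edges (rev_dart e);
  edges_neq0 : forall v : vert, ~ edges (v, v, 0)
}.
Arguments edges {Gam} G : rename.

Section GainGraphs.
Variable Gam : zmodType.
Implicit Type G : gainGraph Gam.

Fixpoint walk G (v : vert G) (s : seq (dart (vert G) Gam)) (w : vert G)
    : Prop :=
  if s is e :: s' then [/\ edges G e, src e = v & walk (tgt e) s' w] else v = w.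

Definition circuit G (s : seq (dart (vert G) Gam)) : Prop :=
  s <> [::] /\ exists v, walk v s v.

Definition total_gain G (s : seq (dart (vert G) Gam)) : Gam :=
  \sum_(e <- s) gain e.

Definition balanced G : Prop :=
  forall s : seq (dart (vert G) Gam), circuit s -> total_gain s = 0.

Definition gconnected G : Prop :=
  (0 < #|vert G|)%N /\ forall v w : vert G, exists s, walk v s w.

Inductive colour := Red | Blue.

Definition is_red (c : colour) : bool := if c is Red then true else false.
Definition is_blue (c : colour) : bool := if c is Blue then true else false.

(* A map on edges, i.e. on orientations up to reversal; its values outside the
   edge set are never used. *)
Record colouring G := Colouring {
  col :> dart (vert G) Gam -> colour;
  col_rev : forall e, edges G e -> col (rev_dart e) = col e
}.

Section ColourSubgraph.
Variables (G : gainGraph Gam) (delta : colouring G) (c : colour).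

Definition colour_edges : set (dart (vert G) Gam) :=
  [set e | edges G e /\ delta e = c].

Lemma colour_edges_rev e : colour_edges e -> colour_edges (rev_dart e).
Proof. by move=> [Ee de]; split; [exact: edges_rev|rewrite col_rev]. Qed.

Lemma colour_edges_neq0 (v : vert G) : ~ colour_edges (v, v, 0).
Proof. by move=> [/edges_neq0]. Qed.

Definition colour_subgraph : gainGraph Gam :=
  GainGraph colour_edges_rev colour_edges_neq0.
End ColourSubgraph.

Section NBAC.
Variables (G : gainGraph Gam) (delta : colouring G).
Implicit Type s : seq (dart (vert G) Gam).

Definition almost_red_circuit s : Prop :=
  circuit s /\ count (fun e => is_blue (delta e)) s = 1%N.

Definition almost_blue_circuit s : Prop :=
  circuit s /\ count (fun e => is_red (delta e)) s = 1%N.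

Definition NBAC_colouring : Prop :=
  [/\ forall c : colour, exists2 e, edges G e & delta e = c,
      ~ (exists2 s, almost_red_circuit s & total_gain s = 0) &
      ~ (exists2 s, almost_blue_circuit s & total_gain s = 0)].

Definition fixed_lattice_NBAC_colouring : Prop :=
  NBAC_colouring /\
  ((balanced (colour_subgraph delta Red) /\
      ~ (exists s, almost_blue_circuit s)) \/
   (balanced (colour_subgraph delta Blue) /\
      ~ (exists s, almost_red_circuit s))).
End NBAC.

End GainGraphs.

Section Frameworks.
Variables (R : realType) (k : nat).
Implicit Types (L M : 'M[R]_(2, k)) (gamma mu : 'cV[int]_k).

(* The Euclidean structure of R^2; the library norm on matrices is the
   supremum norm. *)
Definition dot (x y : 'cV[R]_2) : R := \sum_i x i 0 * y i 0.
Definition sqnorm (x : 'cV[R]_2) : R := dot x x.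

Definition latt L gamma : 'cV[R]_2 := L *m map_mx intr gamma.

Definition full L : Prop := injective (fun x : 'cV[R]_k => L *m x).

Definition orthogonally_equivalent L M : Prop :=
  forall gamma mu, dot (latt L gamma) (latt L mu) = dot (latt M gamma) (latt M mu).

Variable G : gainGraph 'cV[int]_k.
Implicit Types p q : vert G -> 'cV[R]_2.

Definition placement_lattice p L : Prop :=
  forall e, edges G e -> p (src e) <> p (tgt e) + latt L (gain e).

Definition sqlength p L (v w : vert G) gamma : R :=
  sqnorm (p v - p w - latt L gamma).

Definition equivalent p L q M : Prop :=
  forall e, edges G e ->
    sqlength p L (src e) (tgt e) (gain e) =
    sqlength q M (src e) (tgt e) (gain e).

Definition congruent p L q M : Prop :=
  forall v w gamma, sqlength p L v w gamma = sqlength q M v w gamma.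

(* Only the values of the path on [0, 1] matter. Since the vertex set is
   finite, continuity in (R^2)^V * M_(2,k)(R) is continuity of the position of
   each vertex and of the lattice. *)
Definition flex p L (pt : R -> vert G -> 'cV[R]_2) (Lt : R -> 'M[R]_(2, k))
    : Prop :=
  [/\ (forall v, {within `[0, 1], continuous (fun t => pt t v)}) /\
      {within `[0, 1], continuous Lt},
      forall t, t \in `[0, 1] -> placement_lattice (pt t) (Lt t),
      pt 0 = p /\ Lt 0 = L &
      forall t, t \in `[0, 1] -> equivalent (pt t) (Lt t) p L].

Definition fixed_lattice_flex p L pt Lt : Prop :=
  flex p L pt Lt /\
  forall t, t \in `[0, 1] -> orthogonally_equivalent (Lt t) L.

Definition trivial_flex p L (pt : R -> vert G -> 'cV[R]_2)
    (Lt : R -> 'M[R]_(2, k)) : Prop :=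
  forall t, t \in `[0, 1] -> congruent (pt t) (Lt t) p L.

Definition fixed_lattice_flexible p L : Prop :=
  exists pt Lt, fixed_lattice_flex p L pt Lt /\ ~ trivial_flex p L pt Lt.

End Frameworks.

(* Main.v *)
(* A flex is built from two maps a, b : V -> R^2 such that along every edge
   either b changes and a changes exactly by the lattice vector of the edge, or
   b does not change: with a fixed lattice, moving the vertex v to
   a(v) + rot_t(b(v)) preserves all edge lengths. For a fixed lattice
   NBAC-colouring, a comes from a potential of the balanced colour and b
   separates the components of the other one; for a balanced graph, a comes
   from a potential and b is injective.

   Conversely, identify R^2 with the complex plane and multiply everything by
   the conjugate of the first lattice vector, which makes the lattice constant.
   An edge vector is then a complex function W_e of the time t, and W_e times
   its conjugate is a nonzero constant. A nontrivial flex makes some W_e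
   nonconstant, hence transcendental over the constants; in place of a
   valuation of a function field, Zorn's lemma gives a subring O of the ring of
   all functions of t which contains the constants and W_e but not its inverse,
   and contains z or z^-1 for every invertible z. Colour an edge f blue if
   W_f^-1 lies in O and red otherwise. The W_f of a circuit add up to a lattice
   constant, which is a unit of O or zero. A red sum cannot be a unit, so red
   circuits are balanced, and no balanced circuit has exactly one blue edge;
   the conjugates of the W_f, which lie in O exactly for blue f, exclude the
   circuits with exactly one red edge. *)

Require Import Defs.
From HB Require Import structures.
From mathcomp Require Import all_boot all_order all_algebra.
From mathcomp Require Import all_classical all_reals all_analysis.
From mathcomp Require Import complex zify ring lra.

Set Implicit Arguments.
Unset Strict Implicit.
Unset Printing Implicit Defensive.

Import Order.TTheory GRing.Theory Num.Theory.
Import numFieldNormedType.Exports.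

Local Open Scope classical_set_scope.
Local Open Scope ring_scope.

(** * Subrings as sets, and adjunction of an element *)

Definition is_subring (A : pzRingType) (S : set A) : Prop :=
  [/\ S 1, forall x y, S x -> S y -> S (x - y) &
      forall x y, S x -> S y -> S (x * y)].

Section Subring.
Variables (A : pzRingType) (S : set A).
Hypothesis subS : is_subring S.

Lemma subring1 : S 1. Proof. by case: subS. Qed.

Lemma subringB x y : S x -> S y -> S (x - y).
Proof. by case: subS => _ + _; exact. Qed.

Lemma subringM x y : S x -> S y -> S (x * y).
Proof. by case: subS => _ _; exact. Qed.

Lemma subring0 : S 0.
Proof. by rewrite -(subrr 1); apply: subringB; exact: subring1. Qed.

Lemma subringN x : S x -> S (- x).
Proof. by move=> Sx; rewrite -sub0r; apply: subringB => //; exact: subring0. Qed.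

Lemma subringD x y : S x -> S y -> S (x + y).
Proof.
by move=> Sx Sy; rewrite -[y]opprK; apply: subringB => //; exact: subringN.
Qed.

Lemma subring_sum (I : Type) (r : seq I) (P : pred I) (F : I -> A) :
  (forall i, P i -> S (F i)) -> S (\sum_(i <- r | P i) F i).
Proof. by move=> SF; apply: big_ind => //; [exact: subring0|exact: subringD]. Qed.

Lemma subring_prod (I : Type) (r : seq I) (P : pred I) (F : I -> A) :
  (forall i, P i -> S (F i)) -> S (\prod_(i <- r | P i) F i).
Proof. by move=> SF; apply: big_ind => //; [exact: subring1|exact: subringM]. Qed.

Lemma subringX x n : S x -> S (x ^+ n).
Proof.
move=> Sx; elim: n => [|n IHn]; first by rewrite expr0; exact: subring1.
by rewrite exprS; exact: subringM.
Qed.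

Lemma subring_det n (M : 'M[A]_n) : (forall i j, S (M i j)) -> S (\det M).
Proof.
move=> SM; apply: subring_sum => s _; apply: subringM.
  by apply: subringX; apply: subringN; exact: subring1.
by apply: subring_prod => i _.
Qed.

End Subring.

(** This is [S[X]], kept inside [{poly A}] because [S] is a set and not a type. *)
Definition coefs_in (A : nzRingType) (S : set A) : set {poly A} :=
  [set p | forall i, S p`_i].

Section Adjoin.
Variables (A : comNzRingType) (S : set A).
Hypothesis subS : is_subring S.

Lemma coefs_inC a : S a -> coefs_in S a%:P.
Proof. by move=> Sa i; rewrite coefC; case: ifP => // _; exact: subring0. Qed.

Lemma coefs_inX : coefs_in S 'X.
Proof.
by move=> i; rewrite coefX; case: (i == 1%N); [exact: subring1|exact: subring0].
Qed.

Lemma coefs_in_subring : is_subring (coefs_in S).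
Proof.
split=> [|p q Sp Sq i|p q Sp Sq i].
- by rewrite -polyC1; apply: coefs_inC; exact: subring1.
- by rewrite coefB; apply: subringB.
- by rewrite coefM; apply: subring_sum => // j _; apply: subringM.
Qed.

Definition adjoin z : set A := [set y | exists2 p, coefs_in S p & y = p.[z]].

Lemma adjoin_subring z : is_subring (adjoin z).
Proof.
have subP := coefs_in_subring.
split=> [|_ _ [p Sp ->] [q Sq ->]|_ _ [p Sp ->] [q Sq ->]].
- by exists 1; rewrite ?hornerE//; exact: (subring1 subP).
- by exists (p - q); rewrite ?hornerE//; exact: (subringB subP).
- by exists (p * q); rewrite ?hornerM//; exact: (subringM subP).
Qed.

Lemma sub_adjoin z : S `<=` adjoin z.
Proof. by move=> a Sa; exists a%:P; rewrite ?hornerC//; exact: coefs_inC. Qed.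

Lemma mem_adjoin z : adjoin z z.
Proof. by exists 'X; rewrite ?hornerX//; exact: coefs_inX. Qed.

(** The determinant of [1 - 'X T] is a polynomial over [S] with constant term 1; evaluating it at
    [x] leaves 1 minus a multiple of [x]. *)
Lemma det_1subr n (T : 'M[A]_n) x : S x -> (forall i j, S (T i j)) ->
  exists2 c, S c & \det (1%:M - x *: T) = 1 - x * c.
Proof.
move=> Sx ST; have subP := coefs_in_subring.
pose D : 'M[{poly A}]_n := 1%:M - 'X *: map_mx polyC T.
have evD a : (\det D).[a] = \det (1%:M - a *: T).
  rewrite -[LHS]/(horner_eval a (\det D)) -det_map_mx; congr (\det _).
  apply/matrixP => i j; rewrite !mxE /=.
  rewrite /horner_eval hornerD hornerN hornerM hornerX hornerC.
  by case: (i == j); rewrite /= ?hornerE.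
have SD : coefs_in S (\det D).
  apply: (subring_det subP) => i j; rewrite !mxE; apply: (subringB subP).
    by case: (i == j); [exact: subring1|exact: subring0].
  by apply: (subringM subP); [exact: coefs_inX|exact: coefs_inC].
have D0 : (\det D)`_0 = 1.
  by rewrite -horner_coef0 evD scale0r subr0 det1.
exists (- (\sum_(i < (size (\det D)).-1) (\det D)`_i.+1 * x ^+ i)).
  apply: (subringN subS); apply: (subring_sum subS) => i _.
  by apply: (subringM subS) => //; exact: subringX.
rewrite -evD horner_coef.
case sD: (size (\det D)) => [|m].
  by move: D0; rewrite nth_default ?sD // => /eqP; rewrite eq_sym oner_eq0.
rewrite big_ord_recl /= D0 expr0 mulr1 mulrN opprK mulr_sumr; congr (_ + _).
by apply: eq_bigr => i _; rewrite /bump /= add1n exprS mulrCA.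
Qed.

(* The powers z^0, ..., z^(2N-1) are [x * S]-combinations of each other, so
   the determinant trick yields an equation [1 = x * c] with c in S. *)
Lemma invertible_dichotomy x z z' : S x -> z * z' = 1 ->
  (exists2 p, coefs_in S p & 1 = x * p.[z]) ->
  (exists2 q, coefs_in S q & 1 = x * q.[z']) ->
  exists2 c, S c & 1 = x * c.
Proof.
move=> Sx zz' [p Sp p1] [q Sq q1].
pose N := (maxn (size p) (size q)).+1.
have hp : p.[z] = \sum_(i < N.+1) p`_i * z ^+ i.
  apply: horner_coef_wide.
  by rewrite (leq_trans (leq_maxl _ (size q)))// /N ltnW.
have hq : q.[z'] = \sum_(i < N.+1) q`_i * z' ^+ i.
  apply: horner_coef_wide.
  by rewrite (leq_trans (leq_maxr (size p) _))// /N ltnW.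
(* Row [i] expands [z ^+ i]: as [x p(z) z^i] into higher powers if [i < N], as [x q(z') z^i] into
   lower powers otherwise. Since [N] exceeds both sizes, all exponents stay between 0 and
   [2N - 1]. *)
pose T : 'M[A]_(N + N) := \matrix_(i, j)
  (if (i < N)%N then (if (i <= j)%N then p`_(j - i) else 0)
   else if (j <= i)%N then q`_(i - j) else 0).
pose v : 'cV[A]_(N + N) := \col_i z ^+ i.
have Tv : x *: (T *m v) = v.
  apply/colP => i; rewrite !mxE; under eq_bigr do rewrite !mxE.
  case: ltnP => iN.
    rewrite -[RHS]mul1r p1 -mulrA hp mulr_suml; congr (_ * _).
    rewrite -(big_mkord xpredT (fun j =>
      (if (i <= j)%N then p`_(j - i) else 0) * z ^+ j)).
    rewrite -(big_mkord xpredT (fun j => p`_j * z ^+ j * z ^+ i)).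
    rewrite (@big_cat_nat _ _ _ i) //=; last by rewrite ltnW // ltn_addr.
    rewrite big1_seq ?add0r; last first.
      move=> j /=; rewrite mem_index_iota => /andP[_ ji].
      by rewrite leqNgt ji mul0r.
    rewrite -{1}[i : nat]add0n big_addn.
    rewrite (@big_cat_nat _ _ _ N.+1) //=; last by rewrite ltn_subRL ltn_add2r.
    rewrite [X in _ + X]big1_seq ?addr0; last first.
      move=> j /=; rewrite mem_index_iota => /andP[Nj _]; rewrite leq_addl addnK.
      rewrite nth_default ?mul0r //.
      by rewrite (leq_trans (leq_maxl _ (size q)))// ltnW // ltnW.
    by apply: eq_bigr => j _; rewrite leq_addl addnK -mulrA -exprD.
  rewrite -[RHS]mul1r q1 -mulrA hq mulr_suml; congr (_ * _).
  rewrite -(big_mkord xpredT (fun j =>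
    (if (j <= i)%N then q`_(i - j) else 0) * z ^+ j)).
  rewrite -(big_mkord xpredT (fun j => q`_j * z' ^+ j * z ^+ i)).
  rewrite (@big_cat_nat _ _ _ i.+1) //=.
  rewrite [X in _ + X]big1_seq ?addr0; last first.
    move=> j /=; rewrite mem_index_iota => /andP[ij _].
    by rewrite leqNgt ij mul0r.
  rewrite big_nat_rev /= add0n.
  rewrite (@big_cat_nat _ _ _ N.+1) //=.
  rewrite [X in _ + X]big1_seq ?addr0; last first.
    move=> j /=; rewrite mem_index_iota => /andP[Nj ji].
    rewrite subSS leq_subr subKn // nth_default ?mul0r //.
    by rewrite (leq_trans (leq_maxr (size p) _))// ltnW // ltnW.
  apply: eq_big_nat => j /= jN.
  have ji : (j <= i)%N by rewrite (leq_trans _ iN).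
  rewrite subSS leq_subr subKn // -mulrA; congr (_ * _).
  have -> : z ^+ i = z ^+ j * z ^+ (i - j) by rewrite -exprD subnKC.
  by rewrite mulrA -exprMn (mulrC z') zz' expr1n mul1r.
have [c Sc dc] : exists2 c, S c & \det (1%:M - x *: T) = 1 - x * c.
  apply: (det_1subr Sx) => i j; rewrite mxE.
  by case: ifP => _; case: ifP => _ //; exact: (subring0 subS).
exists c => //; apply/eqP; rewrite -subr_eq0 -dc; apply/eqP.
have v0 : (1%:M - x *: T) *m v = 0.
  by rewrite mulmxBl mul1mx -scalemxAl Tv subrr.
(* The adjugate shows that the determinant annihilates [v], whose entry of index 0 is [z ^+ 0 = 1];
   hence the determinant is 0. *)
have := congr1 (mulmx (\adj (1%:M - x *: T))) v0.
rewrite mulmxA mul_adj_mx mulmx0 mul_scalar_mx => /colP/(_ (lshift N ord0)).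
by rewrite !mxE /= expr0 mulr1.
Qed.

End Adjoin.

(** * Valuation subrings of a commutative ring *)

Section ValuationSubring.
Variable A : comNzRingType.

(** The ring [A] will be a ring of functions, with zero divisors, so the valuation condition is
    imposed on invertible elements only. *)
Definition is_valuation_subring (O : set A) : Prop :=
  is_subring O /\ forall z z', z * z' = 1 -> O z \/ O z'.

(** Take [O] maximal among the subrings containing [S] in which [x] has no inverse. If [z] and its
    inverse were both outside [O], then [x] would become invertible in both [O[z]] and [O[z']],
    hence in [O] by [invertible_dichotomy]. *)
Lemma exists_valuation_subring (S : set A) (x : A) :
  is_subring S -> S x -> ~ (exists2 c, S c & 1 = x * c) ->
  exists O : set A, [/\ is_valuation_subring O, S `<=` O &
    ~ (exists2 c, O c & 1 = x * c)].
Proof.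
move=> subS Sx nSx.
(* Zorn's lemma is applied to the sets X such that [S `|` X] is good, so that
   the empty chain needs no special treatment. *)
pose good (O : set A) := is_subring O /\ ~ (exists2 c, O c & 1 = x * c).
have [F Fgood Ftot|X [[subO nOx] maxX]] :=
    @Zorn_bigcup A [set X | good (S `|` X)].
  have common u v : (S `|` \bigcup_(X in F) X) u ->
      (S `|` \bigcup_(X in F) X) v ->
      exists Y, [/\ good (S `|` Y), (S `|` Y) u, (S `|` Y) v &
                    S `|` Y `<=` S `|` \bigcup_(X in F) X].
    have FS Y : F Y -> S `|` Y `<=` S `|` \bigcup_(X in F) X.
      by move=> FY; apply: setUS => w Yw; exists Y.
    move=> [Su|[Y FY Yu]] [Sv|[Y' FY' Y'v]].
    - exists set0; rewrite !setU0; split=> //; by left.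
    - by exists Y'; split; [exact: Fgood|left|right|exact: FS].
    - by exists Y; split; [exact: Fgood|right|left|exact: FS].
    - have [YY'|Y'Y] := Ftot _ _ FY FY'.
        by exists Y'; split; [exact: Fgood|right; exact: YY'|right|exact: FS].
      by exists Y; split; [exact: Fgood|right|right; exact: Y'Y|exact: FS].
  split; [split|].
  - by left; exact: subring1.
  - move=> u v /common /[apply] -[Y [[subY _] Yu Yv]]; apply.
    exact: subringB.
  - move=> u v /common /[apply] -[Y [[subY _] Yu Yv]]; apply.
    exact: subringM.
  - move=> [c Fc xc]; have [Y [[_ nY] Yc _ _]] := common _ _ Fc Fc.
    by apply: nY; exists c.
set O := S `|` X in subO nOx.
(* By maximality, adjoining any [z] outside [O] makes [x] invertible. *)
have extend z : ~ O z -> exists2 p, coefs_in O p & 1 = x * p.[z].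
  move=> nOz; apply: contrapT => nz; apply: (maxX (adjoin O z)).
    split; first by move=> u Xu; apply: sub_adjoin => //; right.
    move=> /(_ z (mem_adjoin subO z)) Xz; apply: nOz; by right.
  rewrite /mkset (_ : S `|` adjoin O z = adjoin O z).
    split; first exact: adjoin_subring.
    by move=> [c [p Op cE] xp]; apply: nz; exists p; rewrite -?cE.
  by apply/setUidPr => u Su; apply: sub_adjoin => //; left.
exists O; split=> //; last by move=> u Su; left.
split=> // z z' zz'; apply: contrapT => /not_orP[nOz nOz'].
apply: nOx; apply: (invertible_dichotomy subO _ zz'); first by left.
  exact: extend.
exact: extend.
Qed.

Section Domination.
Variables (O : set A) (I : eqType) (y y' : I -> A).
Hypothesis valO : is_valuation_subring O.

(** Divisibility over [O] is a total preorder on invertible elements, so a finite family has a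
    member dividing all the others, that is, one of least valuation. *)
Lemma exists_dominant (s : seq I) : s <> [::] ->
  (forall i, i \in s -> y i * y' i = 1) ->
  exists2 j, j \in s & forall i, i \in s -> O (y i * y' j).
Proof.
have [subO O_total] := valO.
elim: s => // i0 [|i1 s] IHs _ yy'.
  exists i0; rewrite ?mem_head// => i; rewrite inE => /eqP ->.
  by rewrite yy' ?mem_head//; exact: subring1.
have [//|i si|j sj Oj] := IHs.
  by apply: yy'; rewrite in_cons si orbT.
have yj : y j * y' j = 1 by apply: yy'; rewrite in_cons sj orbT.
have y0 : y i0 * y' i0 = 1 by apply: yy'; rewrite mem_head.
have [|O0|O0] := O_total (y i0 * y' j) (y j * y' i0).
- have -> : y i0 * y' j * (y j * y' i0) = (y i0 * y' i0) * (y j * y' j) by ring.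
  by rewrite y0 yj mulr1.
- exists j; first by rewrite in_cons sj orbT.
  by move=> i; rewrite in_cons => /orP[/eqP -> //|]; exact: Oj.
- exists i0; rewrite ?mem_head// => i; rewrite in_cons => /orP[/eqP ->|si].
    by rewrite y0; exact: subring1.
  suff -> : y i * y' i0 = (y i * y' j) * (y j * y' i0).
    by apply: (subringM subO) => //; exact: Oj.
  have -> : y i * y' j * (y j * y' i0) = y i * y' i0 * (y j * y' j) by ring.
  by rewrite yj mulr1.
Qed.

(* A finite sum of elements of the maximal ideal is not a unit of O. *)
Lemma sum_nonunits_neq1 (s : seq I) b :
  (forall i, i \in s -> y i * y' i = 1 /\ ~ O (y' i)) -> O b ->
  (\sum_(i <- s) y i) * b <> 1.
Proof.
have [subO _] := valO; move=> sP Ob.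
have [->|/eqP s0] := eqVneq s [::].
  by rewrite big_nil mul0r => /eqP; rewrite eq_sym oner_eq0.
have [|j sj Oj] := exists_dominant s0; first by move=> i /sP[].
have [yj nOj] := sP j sj; move=> sb1; apply: nOj.
(* If the product were 1, then [y' j] would be [b] times the sum of the ratios [y i * y' j], all of
   them in [O]. *)
rewrite -[y' j]mul1r -sb1 mulrAC; apply: (subringM subO) => //.
rewrite mulr_suml big_seq_cond; apply: (subring_sum subO) => i.
by rewrite andbT; exact: Oj.
Qed.

End Domination.
End ValuationSubring.

(** * Walks and sums along them *)

Lemma walk_edges (Gam : zmodType) (G : gainGraph Gam) v s w e :
  walk (G := G) v s w -> e \in s -> edges G e.
Proof.
elim: s v => // e0 s IHs v [Ee0 _ ws]; rewrite inE => /orP[/eqP -> //|].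
exact: IHs ws.
Qed.

Lemma walk_colour (Gam : zmodType) (G : gainGraph Gam) (delta : colouring G) c
    v s w : walk (G := colour_subgraph delta c) v s w ->
  walk (G := G) v s w /\ forall e, e \in s -> delta e = c.
Proof.
elim: s v => [|e0 s IHs] v /=; first by move=> ->.
move=> [[Ee0 de0] <- /IHs[ws ds]]; split; first by split.
by move=> e; rewrite inE => /orP[/eqP -> //|]; exact: ds.
Qed.

(** The differences of [P] telescope, and the terms in [lam] add up to that of the total gain. *)
Lemma walk_sum (Gam : zmodType) (G : gainGraph Gam) (A : zmodType)
    (P : vert G -> A) (lam : Gam -> A) v s w :
  {morph lam : x y / x + y} -> walk v s w ->
  \sum_(e <- s) (P (src e) - P (tgt e) - lam (gain e)) =
    P v - P w - lam (total_gain s).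
Proof.
move=> lamD; rewrite /total_gain.
have lam0 : lam 0 = 0 by apply: (addrI (lam 0)); rewrite -lamD !addr0.
elim: s v => [|e s IHs] v /= => [->|[_ <- /IHs]].
  by rewrite !big_nil subrr lam0 subr0.
by rewrite !big_cons lamD => ->; rewrite addrACA opprD [X in X + _]addrA subrK.
Qed.

(** * The colouring defined by a valuation subring *)

Section ValuationColouring.
Variables (Gam : zmodType) (G : gainGraph Gam) (A : comNzRingType).
Variables (O : set A) (P Q : vert G -> A) (lam lam' : Gam -> A).
Variables (Winv : dart (vert G) Gam -> A) (mu nu : dart (vert G) Gam -> A).
(** [W e] stands for the complex edge vector and [Z e] for its conjugate. The hypotheses below make
    their product [mu e] a unit of [O], with inverse [nu e]. *)
Let W e := P (src e) - P (tgt e) - lam (gain e).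
Let Z e := Q (src e) - Q (tgt e) - lam' (gain e).

Hypothesis valO : is_valuation_subring O.
Hypothesis lamD : {morph lam : x y / x + y}.
Hypothesis lam'D : {morph lam' : x y / x + y}.
Hypothesis lam_unit : forall g, g != 0 -> exists2 b, O b & lam g * b = 1.
Hypothesis lam'O : forall g, O (lam' g).
Hypothesis WWinv : forall e, edges G e -> W e * Winv e = 1.
Hypothesis ZE : forall e, edges G e -> Z e = mu e * Winv e.
Hypothesis WinvE : forall e, edges G e -> Winv e = nu e * Z e.
Hypothesis muO : forall e, edges G e -> O (mu e).
Hypothesis nuO : forall e, edges G e -> O (nu e).

Let subO : is_subring O. Proof. by case: valO. Qed.

Let valuation_colour (e : dart (vert G) Gam) : colour :=
  if `[< O (Winv e) >] then Blue else Red.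

Lemma valuation_colour_rev e : edges G e ->
  valuation_colour (rev_dart e) = valuation_colour e.
Proof.
move=> Ee; have Er := edges_rev Ee.
have lam0 : lam 0 = 0 by apply: (addrI (lam 0)); rewrite -lamD !addr0.
have lamN g : lam (- g) = - lam g.
  by apply: (addrI (lam g)); rewrite -lamD !subrr.
have WN : W (rev_dart e) = - W e.
  by rewrite /W /rev_dart /src /tgt /gain /= lamN; ring.
have WinvN : Winv (rev_dart e) = - Winv e.
  have h : W e * Winv (rev_dart e) = -1.
    by apply/eqP; rewrite -eqr_oppLR -mulNr -WN WWinv.
  by rewrite -[LHS]mulr1 -(WWinv Ee) mulrA (mulrC _ (W e)) h mulN1r.
rewrite /valuation_colour WinvN; congr (if _ then _ else _).
apply/asbool_equiv_eq; split=> /(subringN subO)//; by rewrite opprK.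
Qed.

Definition valuation_colouring : colouring G := Colouring valuation_colour_rev.

Lemma valuation_blueP e : valuation_colouring e = Blue <-> O (Winv e).
Proof. by rewrite /= /valuation_colour; split=> [|h]; case: asboolP. Qed.

Lemma valuation_redP e : valuation_colouring e = Red <-> ~ O (Winv e).
Proof. by rewrite /= /valuation_colour; split=> [|h]; case: asboolP. Qed.

(** The terms [W e] of a closed walk add up to [- lam] of its gain. For a nonzero gain this has an
    inverse in [O], which a sum of red terms cannot have. *)
Lemma red_walk_balanced v s : walk v s v ->
  (forall e, e \in s -> valuation_colouring e = Red) -> total_gain s = 0.
Proof.
move=> ws reds; apply/eqP; apply: contrapT => /negP /lam_unit[b Ob lamb].
have /(_ s (- b)) := @sum_nonunits_neq1 _ O _ W Winv valO; apply.
- move=> e es; split; first by apply: WWinv; exact: walk_edges ws es.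
  by apply/valuation_redP; exact: reds.
- exact: subringN.
- by rewrite (walk_sum P lamD ws) subrr sub0r mulrNN.
Qed.

(** With gain 0, the red terms would add up to minus the single blue term, whose inverse lies in
    [O]. *)
Lemma valuation_colouring_almost_red s :
  almost_red_circuit valuation_colouring s -> total_gain s != 0.
Proof.
move=> [[_ [v ws]] cs]; apply/eqP => gs.
pose P0 e := is_blue (valuation_colouring e).
have := walk_sum P lamD ws; rewrite gs subrr.
move: cs; rewrite -size_filter => /eqP.
case fE: [seq i <- s | P0 i] => [|e [|? ?]] //= _.
have : e \in [seq i <- s | P0 i] by rewrite /P0 fE mem_head.
rewrite mem_filter => /andP[be es].
have Ee := walk_edges ws es.
have Ob : O (Winv e).
  by apply/valuation_blueP; move: be; rewrite /P0; case: (valuation_colouring e).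
rewrite (bigID P0) -big_filter fE big_seq1 -big_filter sub0r => sE.
have /(_ [seq i <- s | ~~ P0 i] (- Winv e)) :=
  @sum_nonunits_neq1 _ O _ W Winv valO; apply.
- move=> f; rewrite mem_filter => /andP[rf fs]; split.
    by apply: WWinv; exact: walk_edges ws fs.
  apply: (iffLR (valuation_redP f)); move: rf; rewrite /P0.
  by case: (valuation_colouring f).
- exact: subringN.
- have lam0 : lam 0 = 0 by apply: (addrI (lam 0)); rewrite -lamD !addr0.
  have -> : \sum_(f <- [seq i <- s | ~~ P0 i]) W f = - W e.
    by apply/eqP; rewrite -addr_eq0 addrC; move: sE; rewrite lam0 oppr0 => ->.
  by rewrite mulrNN WWinv.
Qed.

(** Blue edges have [Z f] in [O], and so has the lattice term. The single red edge would then have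
    [Z e], and with it [Winv e], in [O], whatever the gain of the circuit. *)
Lemma valuation_colouring_almost_blue s :
  ~ almost_blue_circuit valuation_colouring s.
Proof.
move=> [[_ [v ws]] cs].
pose P0 e := is_red (valuation_colouring e).
move: cs; rewrite -size_filter => /eqP.
case fE: [seq i <- s | P0 i] => [|e [|? ?]] //= _.
have : e \in [seq i <- s | P0 i] by rewrite /P0 fE mem_head.
rewrite mem_filter => /andP[re es].
have Ee := walk_edges ws es.
have : valuation_colouring e = Red.
  by move: re; rewrite /P0; case: (valuation_colouring e).
have := walk_sum Q lam'D ws; rewrite (bigID P0) -big_filter fE big_seq1.
rewrite subrr sub0r => sE /valuation_redP; apply.
rewrite WinvE //; apply: (subringM subO); first exact: nuO.
rewrite (_ : Z e = - lam' (total_gain s) - \sum_(f <- s | ~~ P0 f) Z f); last first.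
  by rewrite -sE addrK.
apply: (subringB subO); first by apply: (subringN subO).
rewrite big_seq_cond; apply: (subring_sum subO) => f /andP[fs bf].
have Ef := walk_edges ws fs.
rewrite ZE //; apply: (subringM subO); first exact: muO.
by apply/valuation_blueP; move: bf; rewrite /P0; case: (valuation_colouring f).
Qed.

(** The edge [e0] is red. If there is a blue edge too, the colouring is surjective; otherwise every
    circuit is red and hence balanced. *)
Lemma fixed_lattice_NBAC_of_valuation e0 : edges G e0 -> ~ O (Winv e0) ->
  (exists delta : colouring G, fixed_lattice_NBAC_colouring delta) \/
  balanced G.
Proof.
move=> E0 nO0.
have [[e1 E1 b1]|nb] :=
  pselect (exists2 e, edges G e & valuation_colouring e = Blue).
  left; exists valuation_colouring; split; first split.
  - by case; [exists e0 => //; exact/valuation_redP|exists e1].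
  - by move=> [s /valuation_colouring_almost_red /eqP].
  - by move=> [s /valuation_colouring_almost_blue].
  left; split; last by move=> [s /valuation_colouring_almost_blue].
  by move=> s [_ [v /walk_colour[ws reds]]]; exact: red_walk_balanced ws reds.
right=> s [_ [v ws]]; apply: (red_walk_balanced ws) => e es.
case de: (valuation_colouring e) => //; case: nb; exists e => //.
exact: walk_edges ws es.
Qed.

End ValuationColouring.

(** The last hypothesis says that [W] at [e0] is transcendental over the constants. The valuation
    subring is built in the ring of functions [T -> C], above the polynomials in this function. *)
Lemma fixed_lattice_NBAC_of_motion (C : fieldType) (T : pointedType)
    (Gam : zmodType) (G : gainGraph Gam) (P Q : T -> vert G -> C)
    (lam lam' : Gam -> C)
    (W := fun t e => P t (src e) - P t (tgt e) - lam (gain e))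
    (Z := fun t e => Q t (src e) - Q t (tgt e) - lam' (gain e)) e0 :
  {morph lam : x y / x + y} -> {morph lam' : x y / x + y} ->
  (forall g, lam g = 0 -> g = 0) ->
  (forall e, edges G e -> exists2 m, m != 0 & forall t, W t e * Z t e = m) ->
  edges G e0 ->
  (forall q : {poly C}, q != 0 -> exists t, q.[W t e0] != 0) ->
  (exists delta : colouring G, fixed_lattice_NBAC_colouring delta) \/
  balanced G.
Proof.
move=> lamD lam'D lam0 WZ E0 infW.
have W0 t e : edges G e -> W t e != 0.
  move=> /WZ[m m0 /(_ t)]; apply: contra_eq_neq => ->.
  by rewrite mul0r eq_sym.
pose A : comNzRingType := T -> C.
pose S : set A := [set f | exists q : {poly C}, f = fun t => q.[W t e0]].
have subS : is_subring S.
  split=> [|_ _ [p ->] [q ->]|_ _ [p ->] [q ->]].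
  - by exists 1; apply/funext => t; rewrite hornerC.
  - by exists (p - q); apply/funext => t; rewrite hornerD hornerN.
  - by exists (p * q); apply/funext => t; rewrite hornerM.
have Scst c : S (fun=> c) by exists c%:P; apply/funext => t; rewrite hornerC.
have Sx : S (fun t => W t e0) by exists 'X; apply/funext => t; rewrite hornerX.
(* An inverse [q(W)] would make [W] a root of [1 - 'X * q] at every time; this polynomial is
   nonzero, since its value at 0 is 1. *)
have nSx : ~ (exists2 c, S c & 1 = (fun t => W t e0) * c).
  move=> [_ [q ->] qE].
  have xq t : W t e0 * q.[W t e0] = 1 := esym (congr1 (fun f => f t) qE).
  have [|t] := infW (1 - 'X * q).
    apply/eqP => /(congr1 (fun r => r.[0])).
    rewrite hornerD hornerN hornerM hornerX !hornerC mul0r subr0 => /eqP.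
    by rewrite oner_eq0.
  by rewrite hornerD hornerN hornerM hornerX hornerC xq subrr eqxx.
have [V [valV SV nV]] := exists_valuation_subring subS Sx nSx.
have Vcst c : V (fun=> c) by apply: SV.
(* The product is constant in time, so it may be read off at any point of [T]. *)
pose m e := W point e * Z point e.
have WZm t e : edges G e -> W t e * Z t e = m e.
  by move=> /WZ[m' _ WZE]; rewrite /m !WZE.
have m0 e : edges G e -> m e != 0.
  by move=> /WZ[m' m'0 WZE]; rewrite /m !WZE.
apply: (@fixed_lattice_NBAC_of_valuation Gam G A V (fun v t => P t v)
  (fun v t => Q t v) (fun g _ => lam g) (fun g _ => lam' g)
  (fun e t => (W t e)^-1) (fun e _ => m e) (fun e _ => (m e)^-1) valV
  _ _ _ _ _ _ _ _ _ e0) => //.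
- by move=> x y; apply/funext => t; exact: lamD.
- by move=> x y; apply/funext => t; exact: lam'D.
- move=> g g0; exists (fun=> (lam g)^-1) => //.
  by apply/funext => t; apply: mulfV; apply: contra_neq g0; exact: lam0.
- by move=> e Ee; apply/funext => t; exact: mulfV (W0 t e Ee).
- move=> e Ee; apply/funext => t; rewrite -[LHS]/(Z t e).
  by rewrite -[RHS]/(m e * (W t e)^-1) -(WZm t e Ee) mulrAC mulfV ?mul1r ?W0.
- move=> e Ee; apply/funext => t; rewrite -[RHS]/((m e)^-1 * Z t e).
  rewrite -(WZm t e Ee) invfM -mulrA mulVf ?mulr1 //.
  by have := m0 e Ee; rewrite -(WZm t e Ee) mulf_eq0 negb_or => /andP[].
- move=> VW; apply: nV; exists (fun t => (W t e0)^-1) => //.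
  by apply/funext => t; apply/esym; exact: mulfV (W0 t e0 E0).
Qed.

(** * The plane as the field of complex numbers *)

Section Plane.
Variable R : realType.
Implicit Types (x y l : 'cV[R]_2).

Definition cross x y : R := x 0 0 * y 1 0 - x 1 0 * y 0 0.

Lemma dotE x y : dot x y = x 0 0 * y 0 0 + x 1 0 * y 1 0.
Proof.
rewrite /dot !big_ord_recl big_ord0 addr0.
by rewrite (_ : lift ord0 ord0 = 1 :> 'I_2) //; exact: val_inj.
Qed.

Lemma dot_cross x y : dot x y ^+ 2 + cross x y ^+ 2 = sqnorm x * sqnorm y.
Proof. by rewrite /sqnorm !dotE /cross; ring. Qed.

Lemma sqnorm_eq0 x : (sqnorm x == 0) = (x == 0).
Proof.
apply/idP/eqP => [|->]; last by rewrite /sqnorm dotE !mxE !mul0r addr0.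
rewrite /sqnorm dotE -!expr2 paddr_eq0 ?sqr_ge0// !sqrf_eq0.
move=> /andP[/eqP x0 /eqP x1].
apply/colP => i; rewrite mxE; case: i => -[|[|//]] hi.
  by rewrite -[RHS]x0; congr (x _ _); apply: val_inj.
by rewrite -[RHS]x1; congr (x _ _); apply: val_inj.
Qed.

(* The complex number [conj l * x], under the identification of R^2 with R[i]. *)
Definition cprod l x : R[i] := (dot l x +i* cross l x)%C.

Lemma cprodD l x y : cprod l (x + y) = cprod l x + cprod l y.
Proof.
apply/eqP; rewrite eq_complex /= !dotE /cross !mxE.
by apply/andP; split; apply/eqP; ring.
Qed.

Lemma cprodN l x : cprod l (- x) = - cprod l x.
Proof.
apply/eqP; rewrite eq_complex /= !dotE /cross !mxE.
by apply/andP; split; apply/eqP; ring.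
Qed.

Lemma cprod_conj l x : cprod l x * (cprod l x)^*%C = (sqnorm l * sqnorm x)%:C%C.
Proof.
rewrite -dot_cross; apply/eqP; rewrite eq_complex /=.
by apply/andP; split; apply/eqP; ring.
Qed.

Lemma cprod_eq0 l x : (cprod l x == 0) = (l == 0) || (x == 0).
Proof.
rewrite -!sqnorm_eq0 -mulf_eq0 -dot_cross paddr_eq0 ?sqr_ge0// !sqrf_eq0.
by rewrite eq_complex.
Qed.

End Plane.

(** * Continuity and intermediate values on the unit interval *)

Section Continuity.
Variables (R : realType) (A : set R).

Lemma within_continuousD (f g : R -> R) : {within A, continuous f} ->
  {within A, continuous g} -> {within A, continuous (fun t => f t + g t)}.
Proof.
by move=> cf cg x; apply: (@continuousD R R (subspace A)); [exact: cf|exact: cg].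
Qed.

Lemma within_continuousN (f : R -> R) : {within A, continuous f} ->
  {within A, continuous (fun t => - f t)}.
Proof. by move=> cf x; apply: (@continuousN R R (subspace A)); exact: cf. Qed.

Lemma within_continuousM (f g : R -> R) : {within A, continuous f} ->
  {within A, continuous g} -> {within A, continuous (fun t => f t * g t)}.
Proof.
by move=> cf cg x; apply: (@continuousM R (subspace A)); [exact: cf|exact: cg].
Qed.

Lemma within_continuous_cst (c : R) : {within A, continuous (fun=> c)}.
Proof. by move=> x; exact: cst_continuous. Qed.

Lemma within_continuous_sum (I : Type) (s : seq I) (f : I -> R -> R) :
  (forall i, {within A, continuous (f i)}) ->
  {within A, continuous (fun t => \sum_(i <- s) f i t)}.
Proof.
move=> cf; elim: s => [|i s IHs].
  by under eq_fun do rewrite big_nil; exact: within_continuous_cst.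
by under eq_fun do rewrite big_cons; exact: within_continuousD.
Qed.

Lemma within_continuous_entry m n (f : R -> 'M[R]_(m, n)) i j :
  {within A, continuous f} -> {within A, continuous (fun t => f t i j)}.
Proof.
move=> cf x; apply: (@continuous_comp (subspace A) _ _ f (fun M => M i j)).
  exact: cf.
exact: coord_continuous.
Qed.

Lemma within_continuous_dot (x y : R -> 'cV[R]_2) :
  (forall i, {within A, continuous (fun t => x t i 0)}) ->
  (forall i, {within A, continuous (fun t => y t i 0)}) ->
  {within A, continuous (fun t => dot (x t) (y t))}.
Proof.
move=> cx cy; apply: within_continuous_sum => i; exact: within_continuousM.
Qed.

Lemma within_continuous_cross (x y : R -> 'cV[R]_2) :
  (forall i, {within A, continuous (fun t => x t i 0)}) ->
  (forall i, {within A, continuous (fun t => y t i 0)}) ->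
  {within A, continuous (fun t => cross (x t) (y t))}.
Proof.
move=> cx cy; apply: within_continuousD; last apply: within_continuousN.
  exact: within_continuousM.
exact: within_continuousM.
Qed.

End Continuity.

Section UnitInterval.
Variable R : realType.

(** Only a change of sign is possible; it would force a zero of [f], and then [f 0 = 0]. *)
Lemma continuous_const_of_sqr (f : R -> R) :
  {within `[0, 1], continuous f} ->
  (forall t, t \in `[0, 1] -> f t ^+ 2 = f 0 ^+ 2) ->
  forall t, t \in `[0, 1] -> f t = f 0.
Proof.
move=> cf f2 t t01.
have /eqP := f2 t t01; rewrite eqf_sqr => /orP[/eqP //|/eqP ft].
have [t0 t1] : 0 <= t /\ t <= 1 by move: t01; rewrite in_itv /= => /andP[].
have [||c ct fc0] := @IVT R f 0 t 0 t0.
- apply: continuous_subspaceW cf => u /=; rewrite !in_itv /= => /andP[-> ut].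
  exact: le_trans ut t1.
- rewrite ft; have [f0|f0] := leP 0 (f 0).
    by rewrite ge_min le_max oppr_le0 f0 orbT.
  by rewrite ge_min le_max oppr_ge0 ltW // orbT.
have c01 : c \in `[0, 1].
  by move: ct; rewrite !in_itv /= => /andP[-> ct]; exact: le_trans ct t1.
have /eqP := f2 c c01; rewrite fc0 expr0n /= eq_sym sqrf_eq0 => /eqP f0.
by rewrite ft f0 oppr0.
Qed.

(* By the intermediate value theorem h takes infinitely many values. *)
Lemma exists_nonroot (C : idomainType) (h : R -> C) (phi : C -> R)
    (q : {poly C}) t1 :
  {within `[0, 1], continuous (phi \o h)} -> t1 \in `[0, 1] ->
  phi (h t1) != phi (h 0) -> q != 0 ->
  exists2 t, t \in `[0, 1] & q.[h t] != 0.
Proof.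
move=> ch t1I ht1 q0; apply: contrapT => nq.
have [t10 t11] : 0 <= t1 /\ t1 <= 1 by move: t1I; rewrite in_itv /= => /andP[].
have root_h t : t \in `[0, 1] -> root q (h t).
  by move=> tI; apply/negPn/negP => hq; apply: nq; exists t.
pose f := phi \o h; pose n := size q.
(* These [size q] distinct levels between [f 0] and [f t1] are all attained, which yields one root
   more than the degree of [q] allows. *)
pose lvl (i : 'I_n) := f 0 + (f t1 - f 0) * (i%:R / n%:R).
have /choice[c cP] : forall i, exists c, c \in `[0, 1] /\ f c = lvl i.
  move=> i; have [||c ct fc] := @IVT R f 0 t1 (lvl i) t10.
  - apply: continuous_subspaceW ch => u /=; rewrite !in_itv /= => /andP[-> ut].
    exact: le_trans ut t11.
  - have n0 : 0 < n%:R :> R by rewrite ltr0n (leq_ltn_trans _ (ltn_ord i)).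
    have r0 : 0 <= i%:R / n%:R :> R by rewrite divr_ge0.
    have r1 : i%:R / n%:R <= 1 :> R by rewrite ler_pdivrMr// mul1r ler_nat ltnW.
    rewrite /lvl; move: (i%:R / n%:R) r0 r1 => r r0 r1.
    rewrite ge_min le_max; have [ff|ff] := leP (f 0) (f t1);
      by apply/andP; split; apply/orP; first [left; nra|right; nra].
  - exists c; split=> //.
    by move: ct; rewrite !in_itv /= => /andP[-> ct]; exact: le_trans ct t11.
have cinj : injective (h \o c).
  move=> i j /= /(congr1 phi); have [_] := cP i; have [_] := cP j.
  rewrite /f /= => -> -> /addrI /mulfI; rewrite subr_eq0 => /(_ ht1).
  have n0 : n%:R != 0 :> R.
    by rewrite pnatr_eq0 -lt0n (leq_ltn_trans _ (ltn_ord i)).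
  by move=> /(mulIf (invr_neq0 n0)) /eqP; rewrite eqr_nat => /eqP /val_inj.
have := @max_poly_roots _ q (map (h \o c) (enum 'I_n)) q0.
rewrite map_inj_uniq // enum_uniq size_map size_enum_ord ltnn => /(_ _ isT) H.
suff : false by [].
by apply: H; apply/allP => _ /mapP[i _ ->]; apply: root_h; case: (cP i).
Qed.

End UnitInterval.

(** * From a flexible framework to a colouring *)

Section Lattice.
Variables (R : realType) (k : nat).
Implicit Types (L : 'M[R]_(2, k)) (g : 'cV[int]_k).

Lemma lattD L : {morph latt L : x y / x + y}.
Proof. by move=> x y; rewrite /latt map_mxD mulmxDr. Qed.

Lemma latt0 L : latt L 0 = 0.
Proof. by rewrite /latt map_mx0 mulmx0. Qed.

Lemma lattN L g : latt L (- g) = - latt L g.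
Proof. by rewrite /latt map_mxN mulmxN. Qed.

Lemma latt_eq0 L g : full L -> (latt L g == 0) = (g == 0).
Proof.
move=> fL; apply/eqP/eqP => [|->]; last exact: latt0.
move=> Lg.
have /fL : L *m map_mx intr g = L *m (0 : 'cV[R]_k) by rewrite mulmx0.
move=> /matrixP gE; apply/matrixP => i j; have := gE i j; rewrite !mxE => /eqP.
by rewrite intr_eq0 => /eqP.
Qed.

Lemma within_continuous_latt (A : set R) (Lt : R -> 'M[R]_(2, k)) g i :
  {within A, continuous Lt} ->
  {within A, continuous (fun t => latt (Lt t) g i 0)}.
Proof.
move=> cL; rewrite /latt; under eq_fun do rewrite mxE.
apply: within_continuous_sum => j; apply: within_continuousM.
  exact: within_continuous_entry.
exact: within_continuous_cst.
Qed.

End Lattice.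

Lemma NBAC_or_balanced_of_flexible (R : realType) (k : nat) (k0 : (0 < k)%N)
    (G : gainGraph 'cV[int]_k) (p : vert G -> 'cV[R]_2) (L : 'M[R]_(2, k)) :
  gconnected G -> placement_lattice p L -> full L ->
  fixed_lattice_flexible p L ->
  (exists delta : colouring G, fixed_lattice_NBAC_colouring delta) \/
  balanced G.
Proof.
move=> [_ conG] placL fL [pt [Lt [[[[cp cL] plact [p0 L0] eqv] orth] ntriv]]].
pose g0 : 'cV[int]_k := \col_i (i == Ordinal k0)%:R.
have g00 : g0 != 0.
  by apply/eqP => /colP/(_ (Ordinal k0)); rewrite !mxE eqxx.
pose l t := latt (Lt t) g0.
have I0 : (0 : R) \in `[0, 1] by rewrite in_itv /= lexx ler01.
have l0N0 : sqnorm (l 0) != 0 by rewrite sqnorm_eq0 /l L0 latt_eq0.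
have lE t : t \in `[0, 1] -> sqnorm (l t) = sqnorm (l 0).
  by move=> tI; rewrite /sqnorm /l L0 orth.
pose lam g := cprod (l 0) (latt L g).
have lamE t g : t \in `[0, 1] -> cprod (l t) (latt (Lt t) g) = lam g.
  move=> tI.
  have dotC u : u \in `[0, 1] ->
      dot (l u) (latt (Lt u) g) = dot (l 0) (latt (Lt 0) g).
    by move=> uI; rewrite /l orth // L0.
  (* Orthogonal equivalence fixes the dot product and, through [dot_cross], the square of the cross
     product; continuity fixes its sign. *)
  have := @continuous_const_of_sqr R (fun t => cross (l t) (latt (Lt t) g)).
  move=> /(_ _ _ t tI) crossC; rewrite /lam /cprod -L0 dotC // crossC //.
    by apply: within_continuous_cross => i; exact: within_continuous_latt.
  move=> u uI; apply: (addrI (dot (l u) (latt (Lt u) g) ^+ 2)).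
  by rewrite dot_cross dotC // dot_cross lE // /sqnorm orth // L0.
(* The flex is controlled on the unit interval only; other times are sent to 0, so that the motion
   is defined on all of [R]. *)
pose cl (t : R) : R := if t \in `[0, 1] then t else 0.
have clI t : cl t \in `[0, 1] by rewrite /cl; case: ifP.
pose W t (v w : vert G) g := cprod (l t) (pt t v - pt t w - latt (Lt t) g).
pose P t v := cprod (l t) (pt t v).
have WE t v w g : t \in `[0, 1] -> W t v w g = P t v - P t w - lam g.
  by move=> tI; rewrite /W !cprodD !cprodN lamE.
(* If no edge vector changed, summing along walks of the connected graph would fix the vectors of
   all pairs of vertices, and the flex would be trivial. *)
have [e1 [E1 [t1 [t1I nc]]]] : exists e, edges G e /\ exists t, t \in `[0, 1] /\
    W t (src e) (tgt e) (gain e) != W 0 (src e) (tgt e) (gain e).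
  apply: contrapT => nE; apply: ntriv => t tI v w g.
  have Wedge e : edges G e ->
      W t (src e) (tgt e) (gain e) = W 0 (src e) (tgt e) (gain e).
    move=> Ee; apply: contrapT => /eqP nW; apply: nE.
    by exists e; split=> //; exists t.
  have Wvw : W t v w g = W 0 v w g.
    have [s ws] := conG v w; rewrite !WE //; congr (_ - _).
    have lamD : {morph lam : x y / x + y}.
      by move=> x y; rewrite /lam lattD cprodD.
    apply: (addIr (- lam (total_gain s))).
    rewrite -(walk_sum (P t) lamD ws) -(walk_sum (P 0) lamD ws).
    apply: eq_big_seq => e es; rewrite -!WE //; apply: Wedge.
    exact: walk_edges ws es.
  have := congr1 (fun z => z * z^*%C) Wvw; rewrite !cprod_conj lE //.
  by move=> [/(mulfI l0N0)]; rewrite p0 L0.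
have [f cf f1] : exists2 f : R[i] -> R,
    {within `[0, 1],
      continuous (fun t => f (W t (src e1) (tgt e1) (gain e1)))} &
    f (W t1 (src e1) (tgt e1) (gain e1)) !=
     f (W 0 (src e1) (tgt e1) (gain e1)).
  have cd i : {within `[0, 1], continuous (fun t =>
      (pt t (src e1) - pt t (tgt e1) - latt (Lt t) (gain e1)) i 0)}.
    rewrite (_ : (fun _ => _) = fun t =>
      pt t (src e1) i 0 - pt t (tgt e1) i 0 - latt (Lt t) (gain e1) i 0);
      last first.
      by apply/funext => t; rewrite !mxE.
    apply: within_continuousD; last first.
      by apply: within_continuousN; exact: within_continuous_latt.
    apply: within_continuousD; last apply: within_continuousN.
      exact: within_continuous_entry.
    exact: within_continuous_entry.
  have cl0 i : {within `[0, 1], continuous (fun t => l t i 0)}.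
    exact: within_continuous_latt.
  move: nc; rewrite eq_complex negb_and => /orP[nc|nc].
    by exists (@complex.Re R) => //=; exact: within_continuous_dot.
  by exists (@complex.Im R) => //=; exact: within_continuous_cross.
apply: (@fixed_lattice_NBAC_of_motion R[i] R _ G (fun t => P (cl t))
  (fun t v => (P (cl t) v)^*%C) lam (fun g => (lam g)^*%C) e1) => //.
- by move=> x y; rewrite /lam lattD cprodD.
- by move=> x y; rewrite /lam lattD cprodD rmorphD.
- move=> g /eqP; rewrite cprod_eq0 -sqnorm_eq0 (negPf l0N0) /=.
  by rewrite latt_eq0 // => /eqP.
- move=> e Ee.
  (* The flex preserves the squared edge length, which is nonzero because [p] and [L] form a
     placement-lattice. *)
  exists (sqnorm (l 0) * sqlength p L (src e) (tgt e) (gain e))%:C%C.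
    rewrite rmorphM mulf_neq0 //=; rewrite fmorph_eq0 //.
    rewrite sqnorm_eq0 -subr_eq0 subr0; apply/eqP => /eqP.
    by rewrite -addrA -opprD subr_eq0 => /eqP; exact: placL.
  move=> t; rewrite -!rmorphB -!WE // cprod_conj lE //.
  by have := eqv _ (clI t) _ Ee; rewrite /sqlength => ->.
- move=> q q0.
  have [//|t tI qt] := @exists_nonroot R R[i]
    (fun t => W t (src e1) (tgt e1) (gain e1)) f q t1 cf t1I f1.
  by exists t; rewrite /= -WE // /cl tI.
Qed.

(** * Rotations and the flexes they generate *)

Section Rotation.
Variable R : realType.
Implicit Types (x y : 'cV[R]_2) (t : R).

Definition perp x : 'cV[R]_2 := \col_i (if i == 0 then - x 1 0 else x 0 0).

Definition rot t x : 'cV[R]_2 := cos t *: x + sin t *: perp x.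

Lemma rotB t x y : rot t (x - y) = rot t x - rot t y.
Proof.
by apply/colP => i; rewrite !mxE; case: ifP => _; ring.
Qed.

Lemma rot0 t : rot t 0 = 0.
Proof. by have := rotB t 0 0; rewrite !subrr. Qed.

Lemma rot_at0 x : rot 0 x = x.
Proof. by rewrite /rot cos0 sin0 scale1r scale0r addr0. Qed.

Lemma sqnorm_rot t x : sqnorm (rot t x) = sqnorm x.
Proof.
rewrite -[RHS]mul1r -(cos2Dsin2 t) /sqnorm !dotE !mxE /=; ring.
Qed.

Lemma dot_rot t x y : dot x (rot t y) = cos t * dot x y - sin t * cross x y.
Proof. by rewrite !dotE /cross !mxE /=; ring. Qed.

Lemma sqnormD x y : sqnorm (x + y) = sqnorm x + sqnorm y + 2 * dot x y.
Proof. by rewrite /sqnorm !dotE !mxE; ring. Qed.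

Lemma dotBl x y z : dot (x - y) z = dot x z - dot y z.
Proof. by rewrite !dotE !mxE; ring. Qed.

Lemma continuous_rot x : continuous (fun t => rot t x).
Proof.
move=> t; apply: cvgD; apply: cvgZr_tmp.
  exact: continuous_cos.
exact: continuous_sin.
Qed.

(* The times 1/2 and 1 suffice, by the double angle formulas. *)
Lemma dot_rot_nonconst x y : x != 0 -> y != 0 ->
  ~ (forall t, t \in `[0, 1] -> dot x (rot t y) = dot x y).
Proof.
move=> x0 y0 const; have sum_neq0 : dot x y ^+ 2 + cross x y ^+ 2 != 0.
  by rewrite dot_cross mulf_neq0 ?sqnorm_eq0.
have h01 : (2^-1 : R) \in `[0, 1] by rewrite in_itv /=; apply/andP; split; lra.
have I1 : (2^-1 *+ 2 : R) \in `[0, 1].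
  by rewrite mulr2n in_itv /=; apply/andP; split; lra.
have := const _ I1; have := const _ h01; rewrite !dot_rot.
rewrite cos_mulr2n sin_mulr2n.
have s0 : sin (2^-1 : R) != 0.
  rewrite gt_eqF // sin_gt0_pi //; have := pi_ge2 R => ?.
  by apply/andP; split; lra.
have cs := cos2Dsin2 (2^-1 : R).
move: sum_neq0 s0 cs; move: (dot x y) (cross x y) (cos _) (sin _) => X Y c s.
move=> XY s0 cs e1 e2.
(* [h1] comes from time 1/2 and [h2] from time 1. Eliminating [s * Y] with [c ^+ 2 + s ^+ 2 = 1]
   leaves [X * (1 - c) = 0], and [s != 0] excludes [c = 1]. *)
have h1 : (c - 1) * X = s * Y by lra.
have csX : (c ^+ 2 + s ^+ 2) * X = X by rewrite cs mul1r.
have h2 : s * (s * X + c * Y) = 0 by lra.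
have h3 : c * ((c - 1) * X) = c * (s * Y) by rewrite h1.
have X0 : X * (1 - c) = 0 by lra.
have c1 : 1 - c != 0.
  apply: contra_neq s0 => c1; apply/eqP; rewrite -sqrf_eq0; apply/eqP.
  by move: cs; rewrite (_ : c = 1) ?expr1n; lra.
move/eqP: X0; rewrite mulf_eq0 (negPf c1) orbF => /eqP X0.
have : s * Y = 0 by rewrite -h1 X0 mulr0.
move/eqP; rewrite mulf_eq0 (negPf s0) /= => /eqP Y0.
by move: XY; rewrite X0 Y0 expr0n addr0 eqxx.
Qed.

End Rotation.

Lemma flexible_of_splitting (R : realType) (k : nat) (k0 : (0 < k)%N)
    (G : gainGraph 'cV[int]_k) (L : 'M[R]_(2, k)) (a b : vert G -> 'cV[R]_2) :
  full L ->
  (forall e, edges G e ->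
     (a (src e) = a (tgt e) + latt L (gain e) /\ b (src e) <> b (tgt e)) \/
     (a (src e) <> a (tgt e) + latt L (gain e) /\ b (src e) = b (tgt e))) ->
  (exists v w, b v <> b w) ->
  exists (p : vert G -> 'cV[R]_2) (M : 'M[R]_(2, k)),
    [/\ placement_lattice p M, full M & fixed_lattice_flexible p M].
Proof.
move=> fL abE [v [w bvw]].
pose pt t v := a v + rot t (b v).
have ptE t v' w' g : pt t v' - pt t w' - latt L g =
    (a v' - a w' - latt L g) + rot t (b v' - b w').
  by rewrite /pt rotB opprD !addrA; apply/colP => i; rewrite !mxE; ring.
have plac t : placement_lattice (pt t) L.
  move=> e Ee /eqP; rewrite -subr_eq0 opprD addrA ptE.
  have [[aE bN]|[aN bE]] := abE e Ee.
    rewrite -(addrA (a _)) -opprD aE subrr add0r -sqnorm_eq0 sqnorm_rot.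
    by rewrite sqnorm_eq0 subr_eq0 => /eqP.
  rewrite bE subrr rot0 addr0 -addrA -opprD subr_eq0 => /eqP; exact: aN.
exists (pt 0), L; split=> //.
exists pt, (fun=> L); split; first split; first split.
- split=> [v'|]; last first.
    by apply: continuous_subspaceT => t; exact: cst_continuous.
  apply: continuous_subspaceT => t; apply: cvgD; first exact: cvg_cst.
  exact: continuous_rot.
- by move=> t _; exact: plac.
- by [].
- move=> t _ e Ee; rewrite /sqlength !ptE.
  have [[aE bN]|[aN bE]] := abE e Ee.
    by rewrite -(addrA (a _)) -opprD aE subrr !add0r !sqnorm_rot.
  by rewrite bE subrr !rot0.
- by [].
pose g0 : 'cV[int]_k := \col_i (i == Ordinal k0)%:R.
have g00 : g0 != 0.
  by apply/eqP => /colP/(_ (Ordinal k0)); rewrite !mxE eqxx.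
move=> triv; apply: (@dot_rot_nonconst R (latt L g0) (b v - b w)).
- by rewrite latt_eq0.
- by rewrite subr_eq0; apply/eqP.
(* Subtracting the conditions for the gains [g0] and 0 isolates the inner product of the lattice
   vector with the rotated [b v - b w]. *)
move=> t tI; have := triv t tI v w g0; have := triv t tI v w 0.
rewrite /sqlength !ptE !(sqnormD _ (rot _ _)) !sqnorm_rot !rot_at0 latt0 subr0.
by rewrite !dotBl; lra.
Qed.

(** * Components and potentials of gain graphs *)

Section Components.
Variables (Gam : zmodType) (G : gainGraph Gam).
Implicit Types (v w : vert G) (s : seq (dart (vert G) Gam)).

Definition linked v w : Prop := exists s, walk (G := G) v s w.

Lemma walk_cat v s w s' u :
  walk (G := G) v s w -> walk w s' u -> walk v (s ++ s') u.
Proof.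
elim: s v => [|e s IHs] v /=; first by move=> ->.
by move=> [Ee sv ws] /(IHs _ ws).
Qed.

Lemma total_gain_cat s s' : total_gain (s ++ s') = total_gain s + total_gain s'.
Proof. by rewrite /total_gain big_cat. Qed.

Lemma walk_rev v s w : walk (G := G) v s w ->
  exists2 s', walk w s' v & total_gain s' = - total_gain s.
Proof.
elim: s v => [|e s IHs] v /=.
  by move=> ->; exists [::]; rewrite // /total_gain big_nil oppr0.
move=> [Ee sv /IHs[s' ws' gs']]; exists (s' ++ [:: rev_dart e]).
  apply: walk_cat ws' _ => /=; split; [exact: edges_rev|by []|exact: sv].
by rewrite total_gain_cat gs' /total_gain big_seq1 big_cons opprD addrC.
Qed.

Lemma linked_sym v w : linked v w -> linked w v.
Proof. by move=> [s /walk_rev[s' ws' _]]; exists s'. Qed.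

Lemma linked_trans v w u : linked v w -> linked w u -> linked v u.
Proof. by move=> [s ws] [s' ws']; exists (s ++ s'); exact: walk_cat ws ws'. Qed.

Lemma linked_edge e : edges G e -> linked (src e) (tgt e).
Proof. by move=> Ee; exists [:: e]. Qed.

(** A representative that depends on the class of [v] only. The default is never reached, since the
    empty walk links [v] to itself. *)
Definition component v : vert G := odflt v [pick w | `[< linked v w >]].

Lemma component_linked v : linked v (component v).
Proof.
by rewrite /component; case: pickP => /= [w /asboolP //|_]; exists [::].
Qed.

Lemma eq_component v w : linked v w <-> component v = component w.
Proof.
split=> [vw|cvw].
  rewrite /component (@eq_pick _ _ (fun u => `[< linked w u >])); last first.
    move=> u; apply/asbool_equiv_eq; split; last exact: linked_trans.
    by apply: linked_trans; exact: linked_sym.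
  by case: pickP => //= /(_ w) /asboolP[]; exists [::].
apply: linked_trans (component_linked v) _; rewrite cvw.
exact: linked_sym (component_linked w).
Qed.

Lemma balanced_walks v w s s' : balanced G ->
  walk (G := G) v s w -> walk v s' w -> total_gain s = total_gain s'.
Proof.
move=> bal ws /walk_rev[s'' ws'' gs''].
have wss := walk_cat ws ws''; apply/eqP.
rewrite -subr_eq0 -gs'' -total_gain_cat.
have [->|/eqP sN] := eqVneq (s ++ s'') [::].
  by rewrite /total_gain big_nil.
by apply/eqP; apply: bal; split=> //; exists v.
Qed.

(** The potential of [v] is the gain of a chosen walk to its representative; balance makes it
    independent of the choice. *)
Lemma balanced_potential : balanced G -> exists phi : vert G -> Gam,
  forall v s w, walk v s w -> phi v = phi w + total_gain s.
Proof.
move=> bal; have /choice[f fP] := component_linked.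
exists (fun v => total_gain (f v)) => v s w ws.
rewrite addrC -total_gain_cat; apply: (balanced_walks bal (fP v)).
have -> : component v = component w by apply/eq_component; exists s.
exact: walk_cat ws (fP w).
Qed.

End Components.

(** * Construction of flexible frameworks *)

Section StandardLattice.
Variables (R : realType) (k : nat).
Hypothesis k2 : (k <= 2)%N.

Definition std_lattice : 'M[R]_(2, k) := \matrix_(i, j) ((i : nat) == j)%:R.

Lemma mul_std_lattice m (x : 'M[R]_(k, m)) j c :
  (std_lattice *m x) (widen_ord k2 j) c = x j c.
Proof.
rewrite mxE (bigD1 j) //= big1 => [|i ij].
  by rewrite mxE eqxx mul1r addr0.
rewrite mxE (_ : _ == _ = false) ?mul0r //.
by apply/negbTE; rewrite eq_sym; exact: ij.
Qed.

Lemma full_std_lattice : full std_lattice.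
Proof.
move=> x y /= xy; apply/colP => j.
by rewrite -[LHS]mul_std_lattice xy mul_std_lattice.
Qed.

End StandardLattice.

(** The edge supplies two vertices with different [b]. A single vertex without edges is balanced
    too, but its fixed lattice flexes are all trivial. *)
Lemma flexible_of_balanced (R : realType) (k : nat) (k0 : (0 < k)%N)
    (k2 : (k <= 2)%N) (G : gainGraph 'cV[int]_k) :
  balanced G -> (exists e, edges G e) ->
  exists (p : vert G -> 'cV[R]_2) (L : 'M[R]_(2, k)),
    [/\ placement_lattice p L, full L & fixed_lattice_flexible p L].
Proof.
move=> bal [e0 E0]; have [phi phiP] := balanced_potential bal.
pose L : 'M[R]_(2, k) := std_lattice R k.
pose b (v : vert G) : 'cV[R]_2 := const_mx (enum_rank v)%:R.
have b_inj : injective b.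
  move=> v w /colP/(_ 0); rewrite !mxE => /eqP.
  by rewrite eqr_nat => /eqP/val_inj/enum_rank_inj.
have edge_neq e : edges G e -> b (src e) <> b (tgt e).
  (* A loop is a circuit, so balance would give it gain 0, which no loop has. *)
  move=> Ee /b_inj loop; have g0 : gain e = 0.
    rewrite -(bal [:: e]); first by rewrite /total_gain big_seq1.
    by split=> //; exists (src e); split.
  apply: (@edges_neq0 _ G (tgt e)); move: g0 loop Ee.
  by case: e => [[v w] g]; rewrite /gain /src /tgt /= => -> ->.
apply: (flexible_of_splitting k0 (L := L) (a := fun v => latt L (phi v))
  (b := b)).
- exact: full_std_lattice.
- move=> e Ee; left; split; last exact: edge_neq.
  rewrite -lattD (phiP (src e) [:: e] (tgt e)); last by [].
  by rewrite /total_gain big_seq1.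
- by exists (src e0), (tgt e0); exact: edge_neq.
Qed.

Lemma eq_of_mul_eq_sub (m : int) (n x y : nat) :
  (x < n)%N -> (y < n)%N -> m * n.+1%:Z = x%:Z - y%:Z -> x = y.
Proof.
move=> xn yn mE; have [m1|[m0|m1]] : m <= -1 \/ m = 0 \/ 1 <= m by lia.
- have : m * n.+1%:Z <= -1 * n.+1%:Z by rewrite ler_wpM2r.
  lia.
- by move: mE; rewrite m0; lia.
- have : 1 * n.+1%:Z <= m * n.+1%:Z by rewrite ler_wpM2r.
  lia.
Qed.

(* The c-components are shifted by distinct multiples of 1/(n+1), with n the
   number of vertices, so that no two of them differ by a lattice vector: this
   keeps the edges of colour c' between different c-components nonzero. *)
Lemma flexible_of_colouring (R : realType) (k : nat) (k0 : (0 < k)%N)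
    (k2 : (k <= 2)%N) (G : gainGraph 'cV[int]_k) (delta : colouring G) c c' :
  (forall e, edges G e -> delta e = c \/ delta e = c') ->
  (exists2 e, edges G e & delta e = c) ->
  balanced (colour_subgraph delta c) ->
  (forall e s v, walk (G := G) v (e :: s) v -> delta e = c ->
     ~ forall f, f \in s -> delta f = c') ->
  (forall e s v, walk (G := G) v (e :: s) v -> delta e = c' ->
     (forall f, f \in s -> delta f = c) -> total_gain (e :: s) <> 0) ->
  exists (p : vert G -> 'cV[R]_2) (L : 'M[R]_(2, k)),
    [/\ placement_lattice p L, full L & fixed_lattice_flexible p L].
Proof.
move=> cc' [e0 E0 c0] bal almost_c' almost_c.
have [phi phiP] := balanced_potential bal.
pose H := colour_subgraph delta c; pose H' := colour_subgraph delta c'.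
pose L : 'M[R]_(2, k) := std_lattice R k.
pose n := #|vert G|.
pose rk (v : vert G) : R := (enum_rank v)%:R.
have rk_inj : injective rk.
  by move=> v w /eqP; rewrite eqr_nat => /eqP/val_inj/enum_rank_inj.
pose i0 : 'I_2 := widen_ord k2 (Ordinal k0).
pose a (v : vert G) : 'cV[R]_2 :=
  latt L (phi v) + (rk (component (G := H) v) / n.+1%:R) *: delta_mx i0 0.
pose b (v : vert G) : 'cV[R]_2 := const_mx (rk (component (G := H') v)).
have bE v w : b v = b w <-> linked (G := H') v w.
  have [cE linkE] := @eq_component _ H' v w.
  split=> [/colP/(_ 0)|vw]; last by rewrite /b cE.
  by rewrite !mxE => /rk_inj.
have c_edge e : edges G e -> delta e = c ->
    a (src e) = a (tgt e) + latt L (gain e) /\ b (src e) <> b (tgt e).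
  move=> Ee ce; split.
    have He : walk (G := H) (src e) [:: e] (tgt e) by [].
    rewrite /a (phiP _ _ _ He) /total_gain big_seq1 lattD.
    rewrite (_ : component (G := H) (src e) = component (G := H) (tgt e)).
      by rewrite addrAC.
    by apply: (iffLR (@eq_component _ H _ _)); exists [:: e].
  (* A [c']-walk back to the source would close [e] to a circuit with exactly one edge of colour
     [c]. *)
  move=> /bE/linked_sym[s /walk_colour[ws cs]].
  by apply: (almost_c' e s (src e)) cs => //=; split.
apply: (flexible_of_splitting k0 (L := L) (a := a) (b := b)).
- exact: full_std_lattice.
- move=> e Ee; have [ce|ce] := cc' e Ee; [left; exact: c_edge|right; split].
    (* If [a] changed by the lattice vector, an entry of the integer vector [d] would be a
       difference of shifts, of absolute value below 1. Then the [c]-components agree and [d = 0],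
       so a [c]-walk closes [e] to a balanced circuit with exactly one edge of colour [c']. *)
    pose d := phi (src e) - phi (tgt e) - gain e.
    have rearrange (u v w x y : 'cV[R]_2) :
        u + v = w + x + y -> u - w - y = x - v.
      by move=> uv; apply/colP => i; move/colP/(_ i): uv; rewrite !mxE; lra.
    move=> /rearrange; rewrite -!lattN -!lattD -/d -scalerBl -mulrBl => dE.
    have d0E : (d (Ordinal k0) 0)%:~R = (rk (component (G := H) (tgt e)) -
        rk (component (G := H) (src e))) / n.+1%:R.
      have := congr1 (fun u : 'cV[R]_2 => u i0 0) dE.
      by rewrite /latt mul_std_lattice !mxE !eqxx mulr1.
    have eq_comp : component (G := H) (tgt e) = component (G := H) (src e).
      apply: enum_rank_inj; apply: val_inj => /=.
      have xn := ltn_ord (enum_rank (component (G := H) (tgt e))).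
      have yn := ltn_ord (enum_rank (component (G := H) (src e))).
      move: d0E xn yn; rewrite /rk -/n.
      move: (nat_of_ord (enum_rank (component (G := H) (tgt e)))) => x.
      move: (nat_of_ord (enum_rank (component (G := H) (src e)))) => y.
      move: (d _ _) => m mE xn yn.
      apply: (@eq_of_mul_eq_sub m n) => //; apply: (@intr_inj R).
      by rewrite rmorphM rmorphB /= -!pmulrn mE divfK // pnatr_eq0.
    have d0 : d = 0.
      apply/eqP; rewrite -(latt_eq0 d (@full_std_lattice R k k2)).
      by rewrite dE eq_comp subrr mul0r scale0r.
    have [s ws] : linked (G := H) (tgt e) (src e).
      exact: (iffRL (@eq_component _ H _ _)).
    have [ws' cs] := walk_colour ws.
    apply: (almost_c e s (src e)) => //=.
    have := d0; rewrite /d (phiP _ _ _ ws) => dE'; apply/eqP.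
    rewrite -oppr_eq0 -dE' /total_gain big_cons -/(total_gain s).
    by rewrite !opprD [phi _ + _]addrA subrr sub0r addrC.
  apply/bE; exact: (@linked_edge _ H').
- by exists (src e0), (tgt e0); case: (c_edge e0 E0 c0).
Qed.

Theorem theorem4p1 (R : realType) (k : nat) (hk : k = 1%N \/ k = 2%N)
  (G : gainGraph 'cV[int]_k) (hG : gconnected G)
  (hE : exists e, edges G e) :
  (exists (p : vert G -> 'cV[R]_2) (L : 'M[R]_(2, k)),
      [/\ placement_lattice p L, full L & fixed_lattice_flexible p L])
  <->
  ((exists delta : colouring G, fixed_lattice_NBAC_colouring delta) \/
   balanced G).
Proof.
have k0 : (0 < k)%N by case: hk => ->.
have k2 : (k <= 2)%N by case: hk => ->.
split=> [[p [L [placL fL flexL]]]|[[delta [[surj nred nblue]]]|bal]].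
- exact: (NBAC_or_balanced_of_flexible k0 hG placL fL flexL).
- have count_other (P : pred colour) s : (forall f, f \in s -> P (delta f)) ->
      count (fun f => ~~ P (delta f)) s = 0%N.
    move=> Ps; apply/eqP; rewrite -leqn0 leqNgt -has_count.
    apply/hasPn => f /Ps.
    by rewrite negbK.
  have circ e s v : walk (G := G) v (e :: s) v -> circuit (G := G) (e :: s).
    by move=> ws; split=> //; exists v.
  have almost_red e s v : walk (G := G) v (e :: s) v -> delta e = Blue ->
      (forall f, f \in s -> delta f = Red) -> almost_red_circuit delta (e :: s).
    move=> ws be rs; split; first exact: circ ws.
    rewrite /= be (eq_count (a2 := fun f => ~~ is_red (delta f))).
      by rewrite count_other // => f /rs ->.
    by move=> f; case: (delta f).
  have almost_blue e s v : walk (G := G) v (e :: s) v -> delta e = Red ->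
      (forall f, f \in s -> delta f = Blue) ->
      almost_blue_circuit delta (e :: s).
    move=> ws be rs; split; first exact: circ ws.
    rewrite /= be (eq_count (a2 := fun f => ~~ is_blue (delta f))).
      by rewrite count_other // => f /rs ->.
    by move=> f; case: (delta f).
  (* The two cases are exchanged by swapping the colours; the balanced colour takes the role of
     [c]. *)
  case=> [[bal nb]|[bal nr]].
    apply: (@flexible_of_colouring R k k0 k2 G delta Red Blue _ (surj Red) bal).
    + by move=> e _; case: (delta e); [left|right].
    + move=> e s v ws re bs; apply: nb; exists (e :: s).
      exact: almost_blue ws re bs.
    + move=> e s v ws be rs g0; apply: nred; exists (e :: s) => //.
      exact: almost_red ws be rs.
  apply: (@flexible_of_colouring R k k0 k2 G delta Blue Red _ (surj Blue) bal).
  + by move=> e _; case: (delta e); [right|left].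
  + move=> e s v ws be rs; apply: nr; exists (e :: s).
    exact: almost_red ws be rs.
  + move=> e s v ws re bs g0; apply: nblue; exists (e :: s) => //.
    exact: almost_blue ws re bs.
- exact: flexible_of_balanced.
Qed.
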